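(* Let $T \in \mathbf{B}(\mathcal H)$. If $T$ is subspace-hypercyclic for some nonzero subspace of $\mathcal H$, then $\sigma(T) \cap S^1 \neq \varnothing$, where $\sigma(T)$ is the spectrum of $T$ and $S^1=\{z\in\mathbb C : |z|=1\}$.
   Context: $\mathcal H$ is a separable Hilbert space over $\mathbb C$; $\mathbf{B}(\mathcal H)$ is the set of bounded linear operators on $\mathcal H$; ''subspace'' always means topologically closed linear subspace; $\mathbb N_0 = \mathbb N\cup\{0\}$. For $x\in\mathcal H$, $\operatorname{Orb}(T,x) := \{T^n x : n\in\mathbb N_0\}$. $T$ is subspace-hypercyclic for a nonzero subspace $\mathcal M$ if there exists $x\in\mathcal H$ such that $\operatorname{Orb}(T,x)\cap\mathcal M$ is dense in $\mathcal M$. *)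

(* Defs.v *)
From HB Require Import structures.
From mathcomp Require Import all_boot all_order all_algebra.
From mathcomp Require Import complex.
From mathcomp Require Import all_classical all_reals all_analysis.
Set Implicit Arguments.
Unset Strict Implicit.
Unset Printing Implicit Defensive.
Import Order.TTheory GRing.Theory Num.Theory.
Import numFieldNormedType.Exports.
Local Open Scope classical_set_scope.
Local Open Scope ring_scope.
Local Open Scope complex_scope.

Record hilbertType (R : realType) := HilbertType {
  hilbert_sort :> completeNormedModType R[i] ;
  inner : {dot hilbert_sort for Num.conj} ;
  inner_normE : forall x : hilbert_sort, `|x| ^+ 2 = inner x x }.

Section Definitions.
Variables (R : realType) (H : hilbertType R).

Definition separable := exists D : set H, countable D /\ dense D.

Definition is_subspace (M : set H) := submod_closed [in M] /\ closed M.

(* [bounded_near T (nbhs 0)] is equivalent to the existence of an operator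
   norm bound, see [linear_boundedP]. *)
Record bounded_op := BoundedOp {
  op_fun :> {linear H -> H} ;
  op_bounded : bounded_near op_fun (nbhs (0 : H)) }.

Definition orbit_set (T : bounded_op) (x : H) : set H :=
  range (fun n : nat => iter n T x).

Definition subspace_hypercyclic (T : bounded_op) (M : set H) :=
  exists x : H, M `<=` closure (orbit_set T x `&` M).

Definition spectrum (T : bounded_op) : set R[i] :=
  [set l | ~ exists S : bounded_op,
     cancel (fun x : H => l *: x - T x) S /\
     cancel S (fun x : H => l *: x - T x)].

End Definitions.

Definition unit_circle (R : realType) : set R[i] := [set z | `|z| = 1].
Arguments unit_circle R : clear implicits.

(* Main.v *)
Require Import Defs.
From mathcomp Require Import all_boot all_order all_algebra.
From mathcomp Require cyclic separable cyclotomic.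
From mathcomp Require Import complex zify.
From mathcomp Require Import all_classical all_reals all_analysis.
Import Order.TTheory GRing.Theory Num.Theory.
Import numFieldNormedType.Exports.
Local Open Scope classical_set_scope.
Local Open Scope ring_scope.

(* If the spectrum misses the unit circle, compactness gives c > 0 such that
   c |y| <= |l y - T y| for all y and all |l| = 1. Averaging over the n-th
   roots of unity turns this into c |T^k x| <= |x - T^n x| for all k < n. If the
   orbit of x meets M densely, then |T^n x| < 1 for arbitrarily large n, so the whole
   orbit is bounded, and its closure cannot contain the unbounded set M. *)

Lemma prim_root_exists (F : numClosedFieldType) (n : nat) :
  (0 < n)%N -> exists z : F, n.-primitive_root z.
Proof.
move=> n0; have [rs Xn] := closed_field_poly_normal ('X^n - 1 : {poly F}).
rewrite (monicP (monicXnsubC 1 n0)) scale1r in Xn.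
have szrs : size rs = n.
  by apply: succn_inj; rewrite -(size_prod_XsubC rs id) -Xn size_XnsubC.
(* Among [n] distinct [n]-th roots of unity one is primitive; distinctness is separability of
   ['X^n - 1], as [n] is nonzero in [F]. *)
have [|||z] := hasP (@cyclic.has_prim_root _ n rs n0 _ _ _); last by exists z.
- by apply/allP => z; rewrite -root_prod_XsubC -Xn.
- by rewrite -separable.separable_prod_XsubC -Xn
     cyclotomic.separable_Xn_sub_1 // pnatr_eq0 -lt0n.
- by rewrite szrs.
Qed.

Lemma norm_prim_root {F : numDomainType} {n : nat} {z : F} :
  n.-primitive_root z -> `|z| = 1.
Proof.
move=> zn; apply/eqP; rewrite -(pexpr_eq1 (prim_order_gt0 zn)) //.
by rewrite -normrX prim_expr_order // normr1.
Qed.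

Lemma sum_prim_root_expr {F : fieldType} {n : nat} (d : nat) {z : F} :
  n.-primitive_root z -> \sum_(j < n) z ^+ (j * d) = (n %| d)%N%:R * n%:R.
Proof.
move=> zn; have zE (j : 'I_n) : true -> z ^+ (j * d) = (z ^+ d) ^+ j.
  by rewrite mulnC exprM.
rewrite (eq_bigr _ zE) (prim_order_dvd zn); have [zd1|zd1] := eqVneq (z ^+ d) 1.
  rewrite mul1r -[n in RHS]card_ord -sumr_const.
  by apply: eq_bigr => j _; rewrite zd1 expr1n.
rewrite mul0r; apply: (@mulfI _ (z ^+ d - 1)); first by rewrite subr_eq0.
by rewrite -subrX1 exprAC (prim_expr_order zn) expr1n subrr mulr0.
Qed.

(* [R[i]] gets its topology only through its [numFieldType] structure. *)
Local Notation complex_field R := (Num.NumField.sort (R[i] : numFieldType)).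

Lemma continuous_real_complex (R : realType) :
  continuous (fun x : R => (x%:C)%C : complex_field R).
Proof.
(* A positive complex number has zero imaginary part, so the radius is a real [e]. *)
move=> x; apply/cvgrPdist_lt => -[e e'] /[1!ltcE]/= /andP[/eqP-> e0].
near=> y; rewrite -rmorphB/= normc_def/= expr0n/= addr0 sqrtr_sqr ltcR.
by near: y; exact: cvgr_dist_lt.
Unshelve. all: by end_near. Qed.

(** The circle is closed and lies in the continuous image of the compact square [[-1, 1] *
    [-1, 1]]. *)
Lemma unit_circle_compact (R : realType) :
  compact (unit_circle R : set (complex_field R)).
Proof.
pose f (p : R * R) : complex_field R := ((p.1)%:C + 'i * (p.2)%:C)%C.
have fc : continuous f.
  move=> p; apply: cvgD.
    by apply: (cvg_comp fst); [exact: cvg_fst|exact: continuous_real_complex].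
  apply: cvgM; first exact: cvg_cst.
  by apply: (cvg_comp snd); [exact: cvg_snd|exact: continuous_real_complex].
have cK : compact (f @` (`[-1, 1] `*` `[-1, 1])).
  apply: continuous_compact; first exact: continuous_subspaceT.
  by apply: compact_setX; exact: segment_compact.
apply: subclosed_compact cK _.
  apply: (@preimage_closed _ _ (fun z : complex_field R => `|z|) [set 1]).
    by move=> z _; exact: norm_continuous.
  apply/accessible_closed_set1/hausdorff_accessible.
  exact: norm_hausdorff.
move=> z /= z1; exists (complex.Re z, complex.Im z); last first.
  by rewrite /f/= -complexE.
have [sq1] : ((complex.Re z ^+ 2 + complex.Im z ^+ 2)%:C = 1)%C.
  by rewrite add_Re2_Im2 z1 expr1n.
split=> /=; rewrite in_itv/= -ler_norml -(@ler_pXn2r _ 2) ?nnegrE//.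
  by rewrite expr1n real_normK ?num_real// -sq1 lerDl sqr_ge0.
by rewrite expr1n real_normK ?num_real// -sq1 lerDr sqr_ge0.
Qed.

Lemma geometric_orbit_sum {K : fieldType} {V : lmodType K} (T : {linear V -> V})
    (l : K) (n : nat) (x : V) :
  let p := \sum_(i < n) l ^+ i *: iter i T x in
  p - l *: T p = x - l ^+ n *: iter n T x.
Proof.
elim: n => [|n IHn] /=.
  by rewrite big_ord0 linear0 scaler0 expr0 scale1r !subrr.
rewrite big_ord_recr (linearD T) (linearZ_LR T) /= scalerDr
  opprD addrACA IHn scalerA -exprS.
by rewrite addrA subrK.
Qed.

(* With [w] a primitive [n]-th root of unity, the vectors
   [p j := \sum_(i < n) w ^+ (i * j) *: T^i x] satisfy
   [p j - w ^+ j *: T (p j) = x - T^n x], and the inverse discrete Fourier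
   transform recovers [T^k x] as an average of unimodular multiples of them. *)
Lemma iter_norm_le {C : numClosedFieldType} {V : normedModType C}
    {T : {linear V -> V}} {c : C} :
  0 <= c -> (forall l, `|l| = 1 -> forall y, c * `|y| <= `|l *: y - T y|) ->
  forall n k x, (k < n)%N -> c * `|iter k T x| <= `|x - iter n T x|.
Proof.
move=> c0 cT n k x kn; have n0 : (0 < n)%N by exact: leq_ltn_trans kn.
have [w wn] := prim_root_exists C n n0.
pose p j := \sum_(i < n) (w ^+ j) ^+ i *: iter i T x.
have p_le j : c * `|p j| <= `|x - iter n T x|.
  have wj1 : `|w ^+ j| = 1 by rewrite normrX (norm_prim_root wn) expr1n.
  have wj0 : w ^+ j != 0 by rewrite -normr_eq0 wj1 oner_eq0.
  have := geometric_orbit_sum T (w ^+ j) n x; rewrite /= -/(p j).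
  rewrite exprAC (prim_expr_order wn) expr1n scale1r => <-.
  (* Factoring out the unimodular [w ^+ j] leaves the hypothesis on [T] at [l = (w ^+ j)^-1]. *)
  rewrite -[X in X - _](scalerKV wj0) -scalerBr normrZ wj1 mul1r.
  by apply: cT; rewrite normfV wj1 invr1.
(* The exponent [j * (n - k)] plays the role of [- j * k], since [w ^+ n = 1]. *)
have iterE : n%:R *: iter k T x = \sum_(j < n) w ^+ (j * (n - k)) *: p j.
  under eq_bigr do rewrite scaler_sumr.
  rewrite exchange_big /=
    (bigD1 (Ordinal kn)) //= [X in _ + X]big1 ?addr0 => [|i ik].
    under eq_bigr do rewrite scalerA -exprM -exprD -mulnDr subnK 1?ltnW//.
    by rewrite -scaler_suml (sum_prim_root_expr _ wn) dvdnn mul1r.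
  under eq_bigr do rewrite scalerA -exprM -exprD -mulnDr.
  rewrite -scaler_suml (sum_prim_root_expr _ wn).
  case: dvdnP => [[q]|]; last by rewrite mul0r scale0r.
  move=> Eq; case/eqP: ik; apply: val_inj => /=.
  (* As [i] and [k] are below [n], [i + (n - k)] lies strictly between [0] and [2 * n]; the quotient
     is [1], whence [i = k]. *)
  move: Eq (ltn_ord i); case: q => [|[|q]]; nia.
rewrite -(ler_pM2l (_ : 0 < n%:R)) ?ltr0n// mulrCA -normr_nat
  -normrZ iterE normr_nat.
apply: (le_trans (ler_wpM2l c0 (ler_norm_sum _ _ _))).
rewrite mulr_sumr mulr_natl -[leRHS]/(_ *+ n)
  -[X in _ *+ X]card_ord -sumr_const.
apply: ler_sum => j _; rewrite normrZ normrX (norm_prim_root wn) expr1n mul1r.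
exact: p_le.
Qed.

Section Operators.
Context {R : realType} {H : hilbertType R}.
Implicit Types T : bounded_op H.

Lemma resolvent_lower_bound T (l : R[i]) : ~ spectrum T l ->
  exists2 c : R[i], 0 < c & forall y, c * `|y| <= `|l *: y - T y|.
Proof.
move=> /contrapT[S [lTK _]].
have /linear_boundedP/pinfty_ex_gt0[r r0 Sr] := op_bounded S.
exists r^-1; first by rewrite invr_gt0.
by move=> y; rewrite ler_pdivrMl// -[in leLHS](lTK y).
Qed.

Lemma unit_circle_lower_bound T : spectrum T `&` unit_circle R = set0 ->
  exists2 c : R[i], 0 < c &
    forall l, `|l| = 1 -> forall y, c * `|y| <= `|l *: y - T y|.
Proof.
move=> sT0.
(* In near-covering form, compactness only asks for a bound valid for [l'] near [l] and all small
   constants [d]. *)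
have /compact_near_coveringP cov := unit_circle_compact R.
have : \forall c \near (0 : complex_field R)^'+,
    unit_circle R `<=` (fun l => forall y, c * `|y| <= `|l *: y - T y|).
  apply: cov => l l1.
  have [|c c0 cl] := resolvent_lower_bound T l.
    by move=> sl; have : (spectrum T `&` unit_circle R) l by []; rewrite sT0.
  (* One half of [c] absorbs the perturbation [l - l'], the other half dominates [d]. *)
  have c20 : 0 < c / 2 by rewrite divr_gt0.
  near=> l' d => y.
  have dc : d < c / 2 by near: d; exact: nbhs_right_lt.
  have ll' : `|l - l'| < c / 2 by near: l'; exact: cvgr_dist_lt.
  rewrite -(lerD2r (`|l - l'| * `|y|)) -normrZ.
  apply: le_trans (ler_normD _ _).
  have -> : l' *: y - T y + (l - l') *: y = l *: y - T y.
    by rewrite scalerBl addrC addrA subrK.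
  rewrite normrZ -mulrDl.
  apply: le_trans (cl y); apply: ler_wpM2r => //.
  by rewrite [leRHS]splitr ltW// ltrD.
move=> near_c; near (0 : complex_field R)^'+ => c.
exists c; first by near: c; exact: nbhs_right_gt.
by near: c.
Unshelve. all: by end_near. Qed.

Lemma submod_scale {M : set H} (a : R[i]) {v : H} :
  submod_closed [in M] -> M v -> M (a *: v).
Proof.
move=> [M0 Mlin] Mv; rewrite -[a *: v]addr0.
by apply/set_mem; apply: (Mlin a v 0) => //; exact: mem_set.
Qed.

(** The open unit ball of [M] is infinite, so it has a point outside the finite closed set of the
    first [k.+1] iterates. Orbit points close enough to it have norm below 1 and index above [k]. *)
Lemma hypercyclic_small_iterates {T} {M : set H} {x v : H} (k : nat) :
  submod_closed [in M] -> M `<=` closure (orbit_set T x `&` M) ->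
  M v -> v != 0 -> exists2 n, (k < n)%N & `|iter n T x| < 1.
Proof.
move=> Msub Mx Mv v0; apply: contrapT => no_small.
pose F := [set iter i T x | i in `I_k.+1].
have finF : finite_set F by apply: finite_image; exact: finite_II.
have closedF : closed F.
  apply: (accessible_finite_set_closed.1 _) finF.
  by apply: hausdorff_accessible; exact: norm_hausdorff.
(* The norm of [w j] is [1 / (j + 2)]: distinct values, all below 1 even at [j = 0]. *)
pose w (j : nat) := (`|v| * j.+2%:R)^-1 *: v.
have w_lt1 j : `|w j| < 1.
  rewrite /w normrZ normfV normrM normr_id normr_nat invfM
    mulrAC mulVf ?normr_eq0//.
  by rewrite mul1r invf_lt1 ?ltr1n// ltr0n.
have wF j : F (w j).
  apply: contrapT => nFw.
  have : nbhs (w j) (~` F `&` [set y | `|y| < 1]).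
    apply: filterI.
      by apply: open_nbhs_nbhs; split=> //; exact: closed_openC.
    near=> y; rewrite /= -[y](subKr (w j)) (le_lt_trans (ler_normB _ _))//
      -ltrBrDl.
    by near: y; apply: cvgr_dist_lt => //; rewrite subr_gt0.
  move=> /(Mx _ (submod_scale _ Msub Mv))[_ [[[n _ <-] _] [/= nF lt1]]].
  apply: no_small; exists n => //; rewrite ltnNge; apply/negP => nk.
  by apply: nF; exists n.
apply: infinite_nat; rewrite (_ : setT = w @^-1` F); last first.
  by apply/seteqP; split=> // j _; exact: wF.
apply: finite_preimage finF => i j _ _ /eqP.
rewrite -subr_eq0 -scalerBl scaler_eq0 (negPf v0) orbF subr_eq0
  (inj_eq invr_inj).
by rewrite (inj_eq (mulfI _)) ?normr_eq0// eqr_nat => /eqP[].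
Unshelve. all: by end_near. Qed.

End Operators.

Theorem theorem4p5 (R : realType) (H : hilbertType R) (Hsep : separable H)
    (T : bounded_op H)
    (HT : exists M : set H,
        [/\ is_subspace M, M <> [set 0] & subspace_hypercyclic T M]) :
  spectrum T `&` unit_circle R !=set0.
Proof.
have [M [[Msub _] Mneq0 [x Mx]]] := HT.
apply/set0P/eqP => /unit_circle_lower_bound[c c0 cT].
have [v Mv v0] : exists2 v, M v & v != 0.
  apply: contrapT => Mtriv; apply: Mneq0; apply/seteqP; split=> [v Mv|_ ->] /=.
    by apply: contrapT => /eqP v0; apply: Mtriv; exists v.
  exact/set_mem/Msub.1.
(* From [c * |T^k x| <= |x - T^n x| <= |x| + |T^n x|], with [n > k] chosen so that [|T^n x| < 1]. *)
pose B := c^-1 * (`|x| + 1).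
have orbitB k : `|iter k T x| <= B.
  have [n kn nx] := hypercyclic_small_iterates k Msub Mx Mv v0.
  rewrite ler_pdivlMl//.
  apply: le_trans (iter_norm_le (ltW c0) cT _ _ x kn) _.
  by rewrite (le_trans (ler_normB _ _))// lerD2l ltW.
have B0 : 0 <= B by exact: le_trans (orbitB 0%N).
(* A point of [M] of norm [B + 1]: an iterate within distance 1 of it would have norm above [B]. *)
pose u := ((B + 1) / `|v|) *: v.
have normu : `|u| = B + 1.
  rewrite normrZ normrM normfV normr_id mulfVK ?normr_eq0//.
  by rewrite ger0_norm// addr_ge0.
have : nbhs u [set y | `|u - y| < 1] by exact: cvgr_dist_lt.
move=> /(Mx u (submod_scale _ Msub Mv))[_ [[[n _ <-] _] /= uTn]].
have : B + 1 < B + 1.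
  rewrite -{1}normu -[u](subrK (iter n T x)) (le_lt_trans (ler_normD _ _))//.
  by rewrite addrC ler_ltD.
by rewrite ltxx.
Qed.
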